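(* Let $\mu \in \mathbb{Z}$ and let $n$ be a positive integer. Then the following are equivalent: (i) For every prime $p\mid n$, $p^{\nu_p(n)} \mid (n/p+\mu)$. (ii) $\sum_{i=1}^{n-1} i^{\phi(n)} \equiv \mu \pmod n$. (iii) $n B_{\phi(n)}\equiv \mu \pmod{n}$. (iv) $\frac{\mu}{n}+\sum_{p \mid n}\frac{1}{p} \in \mathbb{Z}$. (v) $\sum_{p\mid n}\frac{n}{p}+\mu\equiv 0\pmod{n}$.
   Context: Sums indexed by $p\mid n$ run over the distinct prime divisors $p$ of $n$ (empty sums are $0$). $\nu_p(n)=\max\{s: p^s\mid n\}$. $\phi$ is Euler's totient function and $B_k$ denotes the $k$-th Bernoulli number (either sign convention for $B_1=\pm\frac12$ may be used). For rational numbers $r_1,r_2$, the statement $r_1\equiv r_2\pmod n$ means that $n$ divides the numerator (in lowest terms) of $r_1-r_2$. *)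

(* Defs.v *)
From mathcomp Require Import all_boot all_order all_algebra.

Set Implicit Arguments.
Unset Strict Implicit.
Unset Printing Implicit Defensive.

Import Order.TTheory GRing.Theory Num.Theory.
Local Open Scope ring_scope.

(* bernoulli_seq m = [:: B_0; ...; B_(m-1)], each term being determined by the
   previous ones via \sum_(k <= m) 'C(m + 1, k) B_k = [m = 0]
   (see bernoulli_rec). *)
Fixpoint bernoulli_seq (m : nat) : seq rat :=
  if m is m'.+1 then
    let s := bernoulli_seq m' in
    rcons s (((m' == 0%N)%:R - \sum_(k < m') 'C(m'.+1, k)%:R * s`_k)
               / m'.+1%:R)
  else [::].

(* Convention B_1 = -1/2. *)
Definition bernoulli (k : nat) : rat := (bernoulli_seq k.+1)`_k.

(* Convention B_1 = 1/2. *)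
Definition bernoulli_plus (k : nat) : rat := (-1) ^+ k * bernoulli k.

(* numq is the numerator in lowest terms; the denominator of r1 - r2 is not
   required to be coprime to n. *)
Definition rat_eqmod (n : nat) (r1 r2 : rat) : Prop :=
  (n%:Z %| numq (r1 - r2))%Z.

Lemma size_bernoulli_seq m : size (bernoulli_seq m) = m.
Proof. by elim: m => //= m IHm; rewrite size_rcons IHm. Qed.

Lemma nth_bernoulli_seq m k : (k < m)%N -> (bernoulli_seq m)`_k = bernoulli k.
Proof.
elim: m => // m IHm; rewrite ltnS leq_eqVlt => /predU1P[-> //|lt_km].
by rewrite /= nth_rcons size_bernoulli_seq lt_km IHm.
Qed.

Lemma bernoulli_rec m :
  \sum_(k < m.+1) 'C(m.+1, k)%:R * bernoulli k = (m == 0%N)%:R.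
Proof.
rewrite big_ord_recr /= binSn {2}/bernoulli /=.
rewrite nth_rcons size_bernoulli_seq ltnn eqxx mulrC divfK ?pnatr_eq0 //.
under eq_bigr => k _ do rewrite -(nth_bernoulli_seq (ltn_ord k)).
by rewrite addrC subrK.
Qed.

Lemma bernoulli0 : bernoulli 0 = 1.
Proof. by rewrite /bernoulli /= big_ord0 subr0 divr1. Qed.

Lemma bernoulli1 : bernoulli 1 = - 2^-1.
Proof.
have /eqP := bernoulli_rec 1; rewrite big_ord_recl big_ord1 /= bernoulli0.
rewrite bin0 mulr1 addrC addr_eq0 => /eqP.
by move/(congr1 ( *%R 2^-1)); rewrite mulKf // mulrN1.
Qed.

(* Main.v *)
Require Import Defs.
From HB Require Import structures.
From mathcomp Require Import all_boot all_order all_algebra.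
From mathcomp Require Import cyclic ring zify.

Set Implicit Arguments.
Unset Strict Implicit.
Unset Printing Implicit Defensive.

Import Order.TTheory GRing.Theory Num.Theory.
Local Open Scope ring_scope.

(** For a prime [p] dividing [n], with [v] the exponent of [p] in [n],
    [totient (p ^ v)] divides [totient n] and [v <= totient n], so
    [i ^ totient n] is [0] or [1] modulo [p ^ v] according to whether [p]
    divides [i]; counting gives [S = - n / p] modulo [p ^ v] for the power sum
    [S] of (ii), hence [S = - \sum_(p | n) n / p] modulo [n].  This ties (i),
    (ii), (iv) and (v) together.  For (iii), Faulhaber's formula shows by
    induction that [p * B_m] is always [p]-integral (half of the von
    Staudt-Clausen theorem); inserted again in the formula, it shows that
    [n * B_k - S_k(n)] is [n] times a rational with denominator coprime to [n]
    for even [k], and [totient n] is even unless [n <= 2]. *)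

(** * Rationals with denominator coprime to [n] *)

(* Membership in the localization of Z at the prime divisors of [n], a subring
   of the rationals. *)
Definition integral_at (n : nat) : {pred rat} :=
  fun x => coprime n `|denq x|.

(** [denq x] divides [numq x * d] and is coprime to [numq x], so it divides [d]. Hence any
    denominator, reduced or not, can serve as a witness. *)
Lemma integral_atI (n d : nat) (x : rat) :
  coprime n d -> x * d%:R \is a Num.int -> x \in integral_at n.
Proof.
move=> co_nd /intrP[a xd]; rewrite /integral_at unfold_in.
suff dvd_d: (denq x %| d%:Z)%Z.
  by move: dvd_d; rewrite dvdzE => /coprime_dvdr; apply.
rewrite -(@Gauss_dvdzr _ (numq x)).
  2: by rewrite coprimezE coprime_sym coprime_num_den.
apply/dvdzP; exists a; apply: (@intr_inj rat).
by rewrite !intrM numqE -xd pmulrn mulrAC.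
Qed.

Lemma mulr_denq_int (x : rat) : x * `|denq x|%N%:R \is a Num.int.
Proof. by rewrite pmulrn absz_denq -numqE intr_int. Qed.

Lemma integral_at_subring (n : nat) : subring_closed (integral_at n).
Proof.
split=> [|x y ix iy|x y ix iy].
- by apply: (@integral_atI n 1); rewrite ?coprimen1 // mulr1 rpred1.
- apply: (@integral_atI n (`|denq x| * `|denq y|)).
    by rewrite coprimeMr; apply/andP.
  have -> : (x - y) * (`|denq x| * `|denq y|)%N%:R =
    x * `|denq x|%N%:R * `|denq y|%N%:R - y * `|denq y|%N%:R * `|denq x|%N%:R.
    by rewrite natrM; ring.
  by apply: rpredB; apply: rpredM; rewrite ?mulr_denq_int // intr_nat.
- apply: (@integral_atI n (`|denq x| * `|denq y|)).
    by rewrite coprimeMr; apply/andP.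
  by rewrite natrM mulrACA rpredM // mulr_denq_int.
Qed.

HB.instance Definition _ (n : nat) :=
  GRing.isSubringClosed.Build rat (integral_at n) (integral_at_subring n).

Lemma integral_at_prime (n : nat) (x : rat) : (0 < n)%N ->
  (forall p, prime p -> (p %| n)%N -> x \in integral_at p) -> x \in integral_at n.
Proof.
move=> n0 ix; rewrite unfold_in coprime_has_primes ?absz_gt0 ?denq_eq0 //.
apply/hasPn => p; rewrite !mem_primes absz_gt0 denq_eq0 /= => /andP[pp pd].
rewrite pp /= n0 /=; apply/negP => pn; have := ix p pp pn.
by rewrite unfold_in prime_coprime // pd.
Qed.

(** Cross-multiplying by the denominators of [x] and of the sum, both coprime to [n], does not
    affect divisibility by [n]. This turns the rational congruence of (iii) into one between
    integers. *)
Lemma integral_at_dvd (n : nat) (a : int) (x : rat) : x \in integral_at n ->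
  (n%:Z %| numq (n%:R * x + a%:~R))%Z = (n%:Z %| a)%Z.
Proof.
move=> ix; set r := _ + _; set d := denq x.
have co_d : coprimez n d by rewrite coprimezE.
have E : numq r * d = (n%:Z * numq x + a * d) * denq r.
  apply: (@intr_inj rat); rewrite !(intrM, intrD) !numqE -/d /r -pmulrn; ring.
have ir : coprimez n (denq r).
  rewrite coprimezE; have: r \in integral_at n.
    by rewrite rpredD ?rpredM ?rpred_nat // rpred_int.
  by [].
have dvd_nx : (n%:Z %| n%:Z * numq x)%Z by rewrite dvdz_mulr.
by rewrite -(Gauss_dvdzl _ co_d) E (Gauss_dvdzl _ ir) (rpredDl _ dvd_nx) Gauss_dvdzl.
Qed.

(** The [p]-part of [j] is at most [j], hence below [p ^ e.+1], so [p ^ e] cancels it. *)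
Lemma integral_at_pfactor (p e j : nat) : prime p -> (j < p ^ e.+1)%N -> (0 < j)%N ->
  p%:R ^+ e / j%:R \in integral_at p.
Proof.
move=> pp lt_j j0; have [d pd Ej] := pfactor_coprime pp j0.
have le_e : (logn p j <= e)%N.
  have := dvdn_leq j0 (pfactor_dvdnn p j) => le_j.
  by have := leq_ltn_trans le_j lt_j; rewrite ltn_exp2l ?prime_gt1.
apply: (integral_atI pd).
have -> : p%:R ^+ e / j%:R * d%:R = p%:R ^+ (e - logn p j) :> rat.
  rewrite {1}Ej -{1}(subnK le_e) exprD natrM natrX; field.
  have d0 : (0 < d)%N by move: j0; rewrite Ej; case: (d).
  have p0 := prime_gt0 pp.
  by rewrite pnatr_eq0 -lt0n d0 expf_neq0 // pnatr_eq0 -lt0n.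
by rewrite -natrX intr_nat.
Qed.

(** * Faulhaber's formula *)

Lemma bin_subset (m i l : nat) : (i + l <= m)%N ->
  ('C(m, i) * 'C(m - i, l) = 'C(m, l) * 'C(m - l, i))%N.
Proof.
move=> le_m.
have trinomial : forall i l, (i + l <= m)%N ->
    ('C(m, i) * 'C(m - i, l) * (i`! * l`! * (m - i - l)`!) = m`!)%N.
  move=> {le_m} {}i {}l le_m.
  have le_i : (i <= m)%N by lia.
  have le_l : (l <= m - i)%N by lia.
  by rewrite -(bin_fact le_i) -(bin_fact le_l); ring.
apply/eqP; rewrite -(@eqn_pmul2r (i`! * l`! * (m - i - l)`!)) ?muln_gt0 ?fact_gt0 //.
by rewrite trinomial // subnAC [(i`! * _)%N]mulnC trinomial // addnC.
Qed.

(** Induction on [n]: the increments of the powers are expanded by the binomial theorem and the sums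
    exchanged. By [bin_subset] the inner sum becomes the Bernoulli recurrence at [m - l], which
    vanishes unless [l = m]. *)
Lemma faulhaber_bin (m n : nat) :
  \sum_(i < m.+1) 'C(m.+1, i)%:R * bernoulli i * n%:R ^+ (m.+1 - i)
  = m.+1%:R * \sum_(i < n) i%:R ^+ m.
Proof.
elim: n => [|n IHn].
  rewrite big_ord0 mulr0 big1 // => i _.
  by rewrite subSn ?leq_ord // expr0n mulr0.
rewrite [in RHS]big_ord_recr /= mulrDr -IHn.
apply/eqP; rewrite addrC -subr_eq -sumrB; apply/eqP.
transitivity (\sum_(i < m.+1) \sum_(l < m.+1 | (i + l < m.+1)%N)
    'C(m.+1, l)%:R * n%:R ^+ l * ('C(m.+1 - l, i)%:R * bernoulli i) : rat).
  apply: eq_bigr => i _; have le_i := leq_ord i.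
  rewrite -mulrBr -nat1r exprDn subSn // big_ord_recr /= subnn expr0 mul1r binn.
  rewrite mulr1n addrK mulr_sumr -subSn //.
  rewrite (big_ord_widen _ (fun l => 'C(m.+1, i)%:R * bernoulli i *
    (1 ^+ (m.+1 - i - l) * n%:R ^+ l *+ 'C(m.+1 - i, l))) (leq_subr i m.+1)).
  apply: eq_big => [l|l]; rewrite ltn_subRL // => lt_il.
  rewrite expr1n mul1r -mulr_natl.
  have /(congr1 (fun k => k%:R : rat)) := bin_subset (ltnW lt_il).
  by rewrite !natrM => E; rewrite mulrACA -mulrA [_ * 'C(_, _)%:R]mulrC; ring: E.
rewrite (exchange_big_dep xpredT) //=.
have inner (l : 'I_m.+1) :
  \sum_(i < m.+1 | (i + l < m.+1)%N)
    'C(m.+1, l)%:R * n%:R ^+ l * ('C(m.+1 - l, i)%:R * bernoulli i)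
  = 'C(m.+1, l)%:R * n%:R ^+ l * (l == m :> nat)%:R.
  have le_l := leq_ord l; rewrite -mulr_sumr; congr (_ * _).
  have -> : (l == m :> nat) = (m - l == 0)%N by rewrite subn_eq0 eqn_leq le_l.
  rewrite -bernoulli_rec -subSn // (big_ord_widen _
    (fun i => 'C(m.+1 - l, i)%:R * bernoulli i) (leq_subr l m.+1)).
  by apply: eq_bigl => i; rewrite ltn_subRL addnC.
rewrite (eq_bigr _ (fun l _ => inner l)) big_ord_recr /= eqxx mulr1 binSn big1 ?add0r //.
by move=> l _; rewrite (ltn_eqF (ltn_ord l)) mulr0.
Qed.

Lemma faulhaber (m n : nat) :
  \sum_(i < n) i%:R ^+ m
  = \sum_(i < m.+1) 'C(m, i)%:R * bernoulli i * (n%:R ^+ (m - i).+1 / (m - i).+1%:R).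
Proof.
apply: (@mulfI _ m.+1%:R); first by rewrite pnatr_eq0.
rewrite -faulhaber_bin mulr_sumr; apply: eq_bigr => i _.
have le_i := leq_ord i; rewrite -subSn //.
have /(congr1 (fun k => k%:R : rat)) := mul_bin_down m.+1 i.
rewrite /= !natrM => E.
have nz : (m.+1 - i)%:R != 0 :> rat by rewrite pnatr_eq0 subSn.
apply: (mulfI nz); rewrite !mulrA -E; field.
exact: nz.
Qed.

(** * Integrality of Bernoulli numbers *)

(** Strong induction: Faulhaber's formula at [n = p] is solved for its last term [p * B_m]. Each
    other term contains [p * B_i] with [i < m], and the remaining [p ^ (m - i)] absorbs the
    denominator. *)
Lemma mul_prime_bernoulli_integral (p m : nat) : prime p ->
  p%:R * bernoulli m \in integral_at p.
Proof.
move=> pp; elim/ltn_ind: m => m IHm.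
have := faulhaber m p; rewrite big_ord_recr /= subnn binn mul1r expr1 divr1.
rewrite [bernoulli m * _]mulrC => /(canLR (addKr _)) <-.
rewrite addrC rpredB //; first by apply: rpred_sum => i _; rewrite rpredX ?rpred_nat.
apply: rpred_sum => i _.
have -> : 'C(m, i)%:R * bernoulli i * (p%:R ^+ (m - i).+1 / (m - i).+1%:R) =
  'C(m, i)%:R * (p%:R * bernoulli i) * (p%:R ^+ (m - i) / (m - i).+1%:R) :> rat.
  by rewrite exprS; ring.
apply: rpredM; first by rewrite rpredM ?rpred_nat ?IHm.
by apply: integral_at_pfactor; rewrite // ltn_expl ?prime_gt1.
Qed.

Lemma bernoulli_power_sum (n k : nat) : (0 < n)%N -> (0 < k)%N -> ~~ odd k ->
  exists2 x, x \in integral_at n &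
    n%:R * bernoulli k = \sum_(i < n) i%:R ^+ k + n%:R * x.
Proof.
move=> n0 k0 even_k.
(* Faulhaber's formula without its last term [n * B_k], with one factor [n] taken out. *)
exists (- \sum_(i < k) 'C(k, i)%:R * bernoulli i * (n%:R ^+ (k - i) / (k - i).+1%:R)).
  rewrite rpredN; apply: integral_at_prime => // p pp /dvdnP[c ->].
  apply: rpred_sum => i _; set j := (k - i)%N.
  have j0 : (0 < j)%N by rewrite subn_gt0.
  (* One factor [p] makes [B_i] integral, leaving [p ^ j.-1] against the denominator [j.+1]. *)
  have -> : 'C(k, i)%:R * bernoulli i * ((c * p)%:R ^+ j / j.+1%:R) =
    c%:R ^+ j * (p%:R * bernoulli i) *
    ('C(k, i)%:R * (p%:R ^+ j.-1 / j.+1%:R)) :> rat.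
    by rewrite -(prednK j0) natrM exprMn [p%:R ^+ _.+1]exprS; ring.
  apply: rpredM; first by rewrite rpredM ?rpredX ?rpred_nat ?mul_prime_bernoulli_integral.
  (* The term [j = 1] has denominator 2, absorbed by the even factor [k]. *)
  have [j1 | j_neq1] := eqVneq j 1%N.
    have Ei : nat_of_ord i = k.-1 by rewrite /j in j1; lia.
    rewrite j1 expr0 div1r Ei -subn1 bin_sub // bin1.
    by rewrite -(even_halfK even_k) -muln2 natrM mulfK ?rpred_nat.
  apply: rpredM; rewrite ?rpred_nat // integral_at_pfactor // prednK //.
  (* From [j = 2] on, [j.+1 < 2 ^ j <= p ^ j]. *)
  have j2 : (2 <= j)%N by lia.
  apply: (@leq_trans (2 ^ j)); last by rewrite leq_exp2r ?prime_gt1.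
  by case: j j2 {j0 j_neq1} => [|[|j]] // _; elim: j => // j IHj; rewrite expnS; lia.
rewrite faulhaber [in RHS]big_ord_recr /= subnn binn mul1r expr1 divr1 mulrN mulr_sumr.
under [X in _ - X]eq_bigr => i _ do rewrite mulrCA [_ * (_ / _)]mulrA -exprS.
by rewrite addrAC subrr add0r mulrC.
Qed.

(** * The power sum modulo prime powers *)

Lemma power_sum_mod_pfactor (n p : nat) : (0 < n)%N -> prime p -> (p %| n)%N ->
  ((p ^ logn p n)%N%:Z %| \sum_(1 <= i < n) i%:Z ^+ totient n + (n %/ p)%N%:Z)%Z.
Proof.
move=> n0 pp pn; have [d pd En] := pfactor_coprime pp n0; set v := logn p n in En *.
have v0 : (0 < v)%N by rewrite logn_gt0 mem_primes pp n0.
have dvd_phi : (totient (p ^ v) %| totient n)%N.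
  by rewrite En totient_coprime ?dvdn_mull // coprime_sym coprimeXl.
have le_v : (v <= totient n)%N.
  apply: leq_trans (dvdn_leq _ dvd_phi); last by rewrite totient_gt0.
  rewrite totient_pfactor // -(prednK v0) /=.
  apply: (leq_trans (ltn_expl _ (prime_gt1 pp))).
  by rewrite leq_pmull // -ltnS prednK ?prime_gt1 ?prime_gt0.
have En1 : (n.-1.+1 = n)%N by rewrite prednK.
(* The multiples of [p] up to [n]; the [1] accounts for [n] itself. *)
have count : (n %/ p)%N%:Z = 1 + \sum_(1 <= i < n) (p %| i)%N%:Z.
  rewrite divn_count_dvd big_nat_recr //= pn PoszD addrC; congr (_ + _).
  by rewrite (big_morph Posz PoszD (erefl _)).
(* Each power is paired with its expected residue, the indicator that [p] does not divide [i]; the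
   two indicator counts add up to [n]. *)
have -> : \sum_(1 <= i < n) i%:Z ^+ totient n + (n %/ p)%N%:Z =
  \sum_(1 <= i < n) (i%:Z ^+ totient n - (~~ (p %| i)%N)%:Z) + n%:Z.
  rewrite count sumrB.
  have -> : n%:Z = 1 + \sum_(1 <= i < n) 1%:Z.
    by rewrite big_const_nat iter_addr addr0 -{1}En1 natz; lia.
  have -> : \sum_(1 <= i < n) 1%:Z =
    \sum_(1 <= i < n) (p %| i)%N%:Z + \sum_(1 <= i < n) (~~ (p %| i)%N)%:Z.
    by rewrite -big_split /=; apply: eq_bigr => i _; case: (p %| i)%N.
  ring.
rewrite rpredD //; last by rewrite dvdzE /= pfactor_dvdnn.
apply: rpred_sum => i _; case: (boolP (p %| i)%N) => pi /=.
  rewrite subr0 dvdzE abszX /=.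
  exact: dvdn_trans (dvdn_exp2l _ le_v) (dvdn_exp2r _ pi).
have co_i : coprime i (p ^ v) by rewrite coprime_sym coprimeXl // prime_coprime.
case/dvdnP: dvd_phi => c ->.
have -> k : i%:Z ^+ k = (i ^ k)%N%:Z by rewrite -!natz natrX.
rewrite -eqz_mod_dvd !modz_nat eqz_nat.
by rewrite mulnC expnM -modnXm (Euler_exp_totient co_i) modnXm exp1n.
Qed.

Lemma dvdz_pfactorP (n : nat) (a : int) : (0 < n)%N ->
  (n%:Z %| a)%Z <->
  (forall p, prime p -> (p %| n)%N -> ((p ^ logn p n)%N%:Z %| a)%Z).
Proof.
move=> n0; split=> [dvd_a p _ _|dvd_a].
  by apply: dvdz_trans dvd_a; rewrite dvdzE /= pfactor_dvdnn.
rewrite dvdzE; apply/dvdn_partP => // p.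
by rewrite mem_primes p_part => /and3P[pp _ /(dvd_a p pp)]; rewrite dvdzE.
Qed.

(** For a prime [q] other than [p], dividing [n] by [q] leaves its [p]-part intact. *)
Lemma sum_div_primes_mod_pfactor (n p : nat) : (0 < n)%N -> prime p -> (p %| n)%N ->
  ((p ^ logn p n)%N%:Z %| \sum_(q <- primes n) (n %/ q)%N%:Z - (n %/ p)%N%:Z)%Z.
Proof.
move=> n0 pp pn; have p_in : p \in primes n by rewrite mem_primes pp n0.
rewrite (bigD1_seq p) ?primes_uniq //= addrAC subrr add0r big_seq_cond.
apply: rpred_sum => q /andP[]; rewrite mem_primes => /and3P[pq _ qn] neq_qp.
rewrite dvdzE /= -(@Gauss_dvdr _ q); first by rewrite mulnC divnK // pfactor_dvdnn.
by rewrite coprimeXl // prime_coprime // dvdn_prime2 // eq_sym.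
Qed.

Lemma power_sum_mod (n : nat) : (0 < n)%N ->
  (n%:Z %| \sum_(1 <= i < n) i%:Z ^+ totient n
          + \sum_(q <- primes n) (n %/ q)%N%:Z)%Z.
Proof.
move=> n0; apply/dvdz_pfactorP => // p pp pn.
have -> (a b : int) : a + b = a + (n %/ p)%N%:Z + (b - (n %/ p)%N%:Z) by ring.
by rewrite rpredD ?power_sum_mod_pfactor ?sum_div_primes_mod_pfactor.
Qed.

(** * Condition (iii) and the equivalence *)

(* Raise -1 to the power [totient n] modulo [n]. *)
Lemma totient_even (n : nat) : (2 < n)%N -> ~~ odd (totient n).
Proof.
move=> n_gt2; apply/negP => odd_phi.
have co_n : coprime n.-1 n by rewrite -{2}(prednK (ltnW (ltnW n_gt2))) coprimenS.
have sqr1 : (n.-1 ^ 2 = 1 %[mod n])%N.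
  have -> : (n.-1 ^ 2 = (n - 2) * n + 1)%N
    by case: n n_gt2 {odd_phi co_n} => [|[|n]] // _; nia.
  exact: modnMDl.
have := Euler_exp_totient co_n.
rewrite -[totient n]odd_double_half odd_phi add1n expnS -mul2n expnM.
rewrite -modnMmr -modnXm sqr1 modnXm exp1n modnMmr muln1 !modn_small; lia.
Qed.

Lemma bernoulli_eqmod (B : nat -> rat) (n : nat) (mu : int) :
  B = bernoulli \/ B = bernoulli_plus -> (0 < n)%N ->
  (n%:Z %| numq (n%:R * B (totient n) - mu%:~R))%Z =
  (n%:Z %| \sum_(1 <= i < n) i%:Z ^+ totient n - mu)%Z.
Proof.
move=> hB n0.
(* For [n <= 2] the index [totient n] is 1, the odd case; modulo 2 the values [-1] and [1] of
   [2 * B_1] agree, so either convention works. *)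
have [n_le2|n_gt2] := leqP n 2.
  have [->|->] : n = 1%N \/ n = 2%N by lia.
    by rewrite !dvdzE !dvd1n.
  have int_case (a : int) : B 1%N = a%:~R / 2%:R ->
      (2%:Z %| numq (2%:R * B (totient 2) - mu%:~R))%Z = (2%:Z %| a - mu)%Z.
    have -> : totient 2 = 1%N by [].
    by move=> ->; rewrite mulrC divfK // -intrB numq_int.
  rewrite big_nat1 expr1n; case: hB => EB.
    rewrite (int_case (-1)); last by rewrite EB bernoulli1 mulN1r.
    have -> : 1 - mu = 2 + (-1 - mu) by ring.
    by rewrite [RHS]rpredDl.
  rewrite (int_case 1) // EB /bernoulli_plus bernoulli1.
  by rewrite expr1 mulrNN.
have phi_gt1 : (1 < totient n)%N by rewrite totient_gt1.
have even_phi := totient_even n_gt2.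
have -> : B (totient n) = bernoulli (totient n).
  by case: hB => -> //; rewrite /bernoulli_plus -signr_odd (negbTE even_phi) mul1r.
have [x ix ->] := bernoulli_power_sum n0 (ltnW phi_gt1) even_phi.
(* The term [i = 0] vanishes because the exponent is positive. *)
have -> : \sum_(i < n) i%:R ^+ totient n =
  (\sum_(1 <= i < n) i%:Z ^+ totient n)%:~R :> rat.
  rewrite -(big_mkord xpredT (fun i => i%:R ^+ totient n)) big_ltn //.
  rewrite expr0n gtn_eqF ?(ltnW phi_gt1) // add0r rmorph_sum.
  by apply: eq_bigr => i _; rewrite rmorphXn.
by rewrite [_%:~R + _]addrC -addrA -intrB integral_at_dvd.
Qed.

Theorem theorem2 (B : nat -> rat) (hB : B = bernoulli \/ B = bernoulli_plus)
    (mu : int) (n : nat) (hn : (0 < n)%N) :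
  [<-> forall p : nat, prime p -> (p %| n)%N ->
         ((p ^ logn p n)%N%:Z %| (n %/ p)%N%:Z + mu)%Z;
       (\sum_(1 <= i < n) i%:Z ^+ totient n = mu %[mod n%:Z])%Z;
       rat_eqmod n (n%:R * B (totient n)) mu%:~R;
       (mu%:~R / n%:R + \sum_(p <- primes n) p%:R^-1 : rat) \is a Num.int;
       (\sum_(p <- primes n) (n %/ p)%N%:Z + mu = 0 %[mod n%:Z])%Z ].
Proof.
have eqmod0 (a b : int) : (a = b %[mod n%:Z])%Z <-> (n%:Z %| a - b)%Z.
  by rewrite -eqz_mod_dvd; split=> /eqP.
set S := \sum_(1 <= i < n) _; set D := \sum_(p <- primes n) (_ %/ _)%N%:Z.
have PS : (n%:Z %| S + D)%Z := power_sum_mod hn.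
(* From here on, every condition is reduced to [n] dividing [D + mu] or, equivalently, [S - mu]. *)
have SD : (n%:Z %| S - mu)%Z = (n%:Z %| D + mu)%Z.
  have -> : D + mu = S + D - (S - mu) by ring.
  by rewrite [RHS]rpredBl.
have pfactorE : (forall p : nat, prime p -> (p %| n)%N ->
    ((p ^ logn p n)%N%:Z %| (n %/ p)%N%:Z + mu)%Z) <-> (n%:Z %| D + mu)%Z.
  rewrite (dvdz_pfactorP _ hn).
  suff E p : prime p -> (p %| n)%N -> ((p ^ logn p n)%N%:Z %| D + mu)%Z =
      ((p ^ logn p n)%N%:Z %| (n %/ p)%N%:Z + mu)%Z.
    by split=> H p pp pn; have := H p pp pn; rewrite E.
  move=> pp pn; have -> : D + mu = (D - (n %/ p)%N%:Z) + ((n %/ p)%N%:Z + mu) by ring.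
  by rewrite rpredDl // sum_div_primes_mod_pfactor.
have intE : ((mu%:~R / n%:R + \sum_(p <- primes n) p%:R^-1 : rat) \is a Num.int)
    = (n%:Z %| D + mu)%Z.
  have n_neq0 : n%:R != 0 :> rat by rewrite pnatr_eq0 -lt0n.
  have -> : mu%:~R / n%:R + \sum_(p <- primes n) p%:R^-1 = (D + mu)%:~R / n%:R :> rat.
    rewrite addrC intrD mulrDl rmorph_sum mulr_suml; congr (_ + _).
    apply: eq_big_seq => p; rewrite mem_primes => /and3P[pp _ pn] /=.
    have p_neq0 : p%:R != 0 :> rat by rewrite pnatr_eq0 -lt0n prime_gt0.
    by apply: (mulIf n_neq0); rewrite divfK // -{1}(divnK pn) natrM mulrCA mulVf ?mulr1.
  apply/intrP/dvdzP => -[c E]; exists c.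
    by apply: (@intr_inj rat); rewrite intrM -E -pmulrn divfK.
  by rewrite E intrM -pmulrn mulfK.
tfae.
- by move=> /pfactorE; rewrite -SD => /eqmod0.
- by move=> /eqmod0; rewrite /rat_eqmod bernoulli_eqmod.
- by rewrite /rat_eqmod bernoulli_eqmod // intE -SD.
- by rewrite intE => dvd_D; apply/eqmod0; rewrite subr0.
- by move=> /eqmod0; rewrite subr0 => /pfactorE.
Qed.
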